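(* Let $L$ be a countable metric signature and $\Omega$ a weak modulus. Let $A, B$ be separable $L$-structures, let $n\in\mathbb N$ and let $\bar a \in A^n$, $\bar b \in B^n$. Then, for any ordinal $\alpha < \omega_1$, $$r_\alpha(A \bar a, B \bar b) = \sup_\phi |\phi^A(\bar a) - \phi^B(\bar b)|,$$ where the supremum is taken over all $n$-ary $\Omega$-formulas $\phi$ of quantifier rank at most $\alpha$.
   Context: Moduli. For $n\in\mathbb N$ or $n=\mathbb N$, an $n$-ary modulus is a continuous function $\Delta:[0,\infty)^n\to[0,\infty)$ with $\Delta(0)=0$ and $\Delta(\delta)\le\Delta(\delta+\delta')\le\Delta(\delta)+\Delta(\delta')$. A weak modulus is a function $\Omega:[0,\infty)^{\mathbb N}\to[0,\infty]$ with $\Omega(0)=0$ and $\Omega(\delta)\le\Omega(\delta+\delta')\le\Omega(\delta)+\Omega(\delta')$ that is lower semicontinuous for the product topology and separately continuous in each argument; put $\Omega|_n(\delta_0,\dots,\delta_{n-1})=\Omega(\delta_0,\dots,\delta_{n-1},0,0,\dots)$. A map $f$ from a product of metric spaces $\prod_{i<n}X_i$ to a metric space respects $\Delta$ if $d(f(x),f(y))\le\Delta((d(x_i,y_i))_{i<n})$ for all $x,y$. Signatures and structures. A metric signature $L$ is a set of function and predicate symbols; each symbol $s$ has an arity $n_s$ and an $n_s$-ary modulus $\Delta_s$, and each predicate symbol $P$ also has a compact interval $I_P\subseteq\mathbb R$ (its bound). $L$ always contains a binary predicate symbol $d$ with $\Delta_d(\delta_1,\delta_2)=\delta_1+\delta_2$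 and some bound. An $L$-structure $A$ is a complete metric space with maps $F^A:A^{n_F}\to A$ respecting $\Delta_F$ and functions $P^A:A^{n_P}\to I_P$ respecting $\Delta_P$, where $d$ is interpreted as the distance. Formulas. Variables are $x_0,x_1,\dots$. Terms and formulas carry moduli, formulas also carry bounds: $\Delta_{x_i}(\delta)=\delta_i$; $\Delta_{F(\bar\tau)}=\Delta_F\circ(\Delta_{\tau_i})_i$; an atomic formula $P(\bar\tau)$ has modulus $\Delta_P\circ(\Delta_{\tau_i})_i$ and bound $I_P$. If $f:\prod_i I_{\phi_i}\to\mathbb R$ is continuous, $f(\phi_0,\dots,\phi_{m-1})$ has modulus $\Delta_f\circ(\Delta_{\phi_i})_i$ and bound $f(\prod_i I_{\phi_i})$, where $\Delta_f(\delta)=\sup\{|f(x)-f(y)|:|x_i-y_i|\le\delta_i\}$; it is called a basic formula if all $\phi_i$ are atomic. A formula with modulus $\Delta$ and bound $I$ respects any $\Delta'\ge\Delta$ and $I'\supseteq I$. $\phi^A$ denotes the interpretation of $\phi$ in $A$; $\bigvee_i,\bigwedge_i$ (countable) are interpreted as $\sup_i,\inf_i$. $\Omega$-formulas. For a compact interval $I$, $n$-ary $(\Omega,I)$-formulas are defined inductively: (1) basic formulas depending only on $x_0,\dots,x_{n-1}$ that respect $\Omega|_n$ and $I$; (2) $\bigvee_{i\in\mathbb N}\phi_i$ and $\bigwedge_{i\in\mathbb N}\phi_i$ for $n$-ary $(\Omega,I)$-formulas $\phi_i$; (3) $\inf_{x_n}\phi$ and $\sup_{x_n}\phi$ for an $(n+1)$-ary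 $(\Omega,I)$-formula $\phi$; (4) if $\phi_0,\dots,\phi_{k-1}$ are $n$-ary $(\Omega,I)$-formulas and $f:\mathbb R^k\to\mathbb R$ is 1-Lipschitz for the max distance, $f(\phi_0,\dots,\phi_{k-1})$ is an $n$-ary $(\Omega,f(I^k))$-formula. An $n$-ary $\Omega$-formula is an $n$-ary $(\Omega,I)$-formula for some $I$. Quantifier rank: $0$ for atomic formulas; $\operatorname{qr}f(\phi_0,\dots,\phi_{m-1})=\max_i\operatorname{qr}\phi_i$; $\operatorname{qr}\bigvee_i\phi_i=\operatorname{qr}\bigwedge_i\phi_i=\sup_i\operatorname{qr}\phi_i$; $\operatorname{qr}\sup_x\phi=\operatorname{qr}\inf_x\phi=\operatorname{qr}\phi+1$. Back-and-forth pseudo-distances (with respect to $\Omega$), with values in $[0,\infty]$, for $\bar a\in A^n,\bar b\in B^n$: $r_0(A\bar a,B\bar b)=\sup_\phi|\phi^A(\bar a)-\phi^B(\bar b)|$ over all basic $n$-ary $\Omega$-formulas $\phi$; $r_\alpha=\sup_{\beta<\alpha}r_\beta$ for $\alpha$ limit; $r_{\alpha+1}(A\bar a,B\bar b)=\sup_{c\in A,d\in B}\inf_{c'\in A,d'\in B}\max\bigl(r_\alpha(A\bar ac,B\bar bd'),r_\alpha(A\bar ac',B\bar bd)\bigr)$. *)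

(* Defs.v *)
From HB Require Import structures.
From mathcomp Require Import all_boot all_order all_algebra.
From mathcomp Require Import all_classical all_reals all_analysis.
From mathcomp Require wochoice.

Set Implicit Arguments.
Unset Strict Implicit.
Unset Printing Implicit Defensive.

Import Order.TTheory GRing.Theory Num.Theory.
Import numFieldNormedType.Exports.

Local Open Scope classical_set_scope.
Local Open Scope ring_scope.

(* The elements of a fixed well-order of the (uncountable) type [nat -> bool]
   that have countably many predecessors; this initial segment has order type
   [omega_1], so its elements are the countable ordinals. *)
Definition wo_rel : rel (nat -> bool) :=
  sval (wochoice.well_ordering_principle (nat -> bool)).

Definition omega1 : Type :=
  {x : nat -> bool | `[< countable [set y | wo_rel y x] >]}.

HB.instance Definition _ := Choice.on omega1.

Definition omega1_le (x y : omega1) : bool := wo_rel (val x) (val y).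

Lemma wo_relP (X : set (nat -> bool)) :
  X !=set0 -> exists2 z, X z & forall y, X y -> wo_rel z y.
Proof.
move=> [x Xx].
have [|z [[/asboolP zX zl] _]] :=
    svalP (wochoice.well_ordering_principle (nat -> bool)) [pred y | `[< X y >]].
  by exists x; apply/asboolP.
by exists z => // y Xy; apply: zl; apply/asboolP.
Qed.

Lemma wo_rel_total : total wo_rel.
Proof.
move=> x y; have [|z [->|->] h] := @wo_relP [set z | z = x \/ z = y].
- by exists x; left.
- by rewrite h//; right.
- by rewrite (h x) ?orbT//; left.
Qed.

Lemma wo_rel_refl : reflexive wo_rel.
Proof. by move=> x; have := wo_rel_total x x; rewrite orbb. Qed.

Lemma wo_rel_anti : antisymmetric wo_rel.
Proof.
move=> x y /andP[xy yx].
have [|z [_ uz]] := svalP (wochoice.well_ordering_principle (nat -> bool))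
  [pred z | (z == x) || (z == y)].
  by exists x; rewrite inE eqxx.
have m t : t = x \/ t = y -> t = z.
  move=> txy; apply/esym/uz; split.
    by rewrite inE; case: txy => ->; rewrite eqxx ?orbT.
  case: txy => -> u; rewrite inE => /orP[]/eqP ->; rewrite -/wo_rel;
    by rewrite ?wo_rel_refl ?xy ?yx.
by apply: (etrans (m x _)); [left | apply/esym/m; right].
Qed.

Lemma wo_rel_trans : transitive wo_rel.
Proof.
move=> y x z xy yz.
have [|t] := @wo_relP [set t | [\/ t = x, t = y | t = z]].
  by exists x; constructor 1.
case=> -> h.
- by apply: h; constructor 3.
- have -> : x = y by apply: wo_rel_anti; rewrite xy h//; constructor 1.
  exact: yz.
- have <- : y = z by apply: wo_rel_anti; rewrite yz h//; constructor 2.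
  exact: xy.
Qed.

Lemma omega1_le_anti : antisymmetric omega1_le.
Proof. by move=> x y h; apply: val_inj; exact: wo_rel_anti. Qed.

Lemma omega1_le_trans : transitive omega1_le.
Proof. by move=> y x z; exact: wo_rel_trans. Qed.

Fact omega1_display : Order.disp_t. Proof. exact: Order.Disp tt tt. Qed.

HB.instance Definition _ := Order.Le_isPOrder.Build omega1_display omega1
  (fun x => wo_rel_refl (val x)) omega1_le_anti omega1_le_trans.

HB.instance Definition _ := Order.POrder_isTotal.Build omega1_display omega1
  (fun x y => wo_rel_total (val x) (val y)).

Lemma omega1_minP (X : set omega1) :
  X !=set0 -> exists2 z, X z & forall y, X y -> (z <= y)%O.
Proof.
move=> [x Xx]; have [|z [z' Xz' <-] h] := @wo_relP (val @` X).
  by exists (val x), x.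
by exists z' => // y Xy; apply: h; exists y.
Qed.

Lemma omega1_wf : well_founded (fun x y : omega1 => (x < y)%O).
Proof.
move=> x; apply: contrapT => nx.
have [|z nz h] := @omega1_minP [set x | ~ Acc (fun x y : omega1 => (x < y)%O) x].
  by exists x.
apply: nz; constructor => y yz; apply: contrapT => /h.
by rewrite leNgt yz.
Qed.

Lemma omega1_countable_le (x : omega1) : countable [set y | (y <= x)%O].
Proof.
have /asboolP/countable_injP[f fi] := valP x.
apply/countable_injP; exists (f \o val) => y z; rewrite !inE => yx zx /fi.
by rewrite !inE => /(_ yx zx)/val_inj.
Qed.

Lemma omega1_uncountable : ~ countable [set: omega1].
Proof.
move=> /countable_injP[f fi].
pose D : set (nat -> bool) := [set x | countable [set y | wo_rel y x]].
have Dc : countable D.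
  pose v x : nat := if pselect (D x) is left Dx then f (exist _ x (asboolT Dx)) else 0.
  apply/countable_injP; exists v => x y; rewrite !inE /v => Dx Dy.
  case: pselect => // Dx'; case: pselect => // Dy' /fi.
  by rewrite !inE => /(_ I I)/(congr1 val).
have [DT|/existsNP[x nDx]] := pselect (forall x, D x).
  have /countable_injP[g gi] : countable [set: nat -> bool].
    by apply: sub_countable Dc; apply: subset_card_le => x _; exact: DT.
  pose h n := ~~ `[< exists2 x, g x = n & x n >].
  have gI x y : g x = g y -> x = y by move=> /gi; apply; rewrite inE.
  have : h (g h) = ~~ h (g h).
    rewrite {1}/h; congr negb; apply/asboolP/idP => [[x /gI -> //]|hh].
    by exists h.
  by case: (h (g h)).
have [|z nDz zmin] := @wo_relP [set x | ~ D x]; first by exists x.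
apply: nDz; rewrite /D/=.
have zD : [set y | wo_rel y z] `<=` D `|` [set z].
  move=> y /= yz; have [|nDy] := pselect (D y); [by left|right => /=].
  by apply: wo_rel_anti; rewrite yz zmin.
apply: sub_countable (subset_card_le zD) _.
by rewrite -bigcup2E; apply: bigcup_countable => // -[|[|i]] _ //=.
Qed.

Lemma omega1_bounded (X : set omega1) :
  countable X -> exists z, forall y, X y -> (y < z)%O.
Proof.
move=> Xc; apply: contrapT => nb; apply: omega1_uncountable.
have : countable (\bigcup_(y in X) [set z | (z <= y)%O]).
  by apply: bigcup_countable => // y _; exact: omega1_countable_le.
apply: sub_countable; apply: subset_card_le => z _ /=.
apply: contrapT => zX; apply: nb; exists z => y Xy; rewrite ltNge.
by apply/negP => zy; apply: zX; exists y.
Qed.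

Lemma omega1_inh : [set: omega1] !=set0.
Proof. by have [z _] := omega1_bounded (@countable0 omega1); exists z. Qed.

Definition omin (X : set omega1) : omega1 :=
  xget (sval (cid omega1_inh)) (X `&` lbound X).

Definition ozero : omega1 := omin setT.
Definition osucc (x : omega1) : omega1 := omin [set y | (x < y)%O].
Definition osup (X : set omega1) : omega1 := omin (ubound X).

Lemma ominP (X : set omega1) :
  X !=set0 -> X (omin X) /\ forall y, X y -> (omin X <= y)%O.
Proof.
by move=> /omega1_minP[z Xz zl]; rewrite /omin; case: xgetP => [_ -> []|/(_ z)[]].
Qed.

Lemma ozero_le x : (ozero <= x)%O.
Proof. by have [_] := ominP omega1_inh; apply. Qed.

Lemma osuccP x y : (osucc x <= y)%O = (x < y)%O.
Proof.
have [|xs h] := @ominP [set y | (x < y)%O].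
  by have [z xz] := omega1_bounded (countable1 x); exists z; exact: xz.
apply/idP/idP => [|xy]; [exact: lt_le_trans | exact: h].
Qed.

Lemma ltosucc x : (x < osucc x)%O.
Proof. by rewrite -osuccP. Qed.

Lemma osucc_inj : injective osucc.
Proof.
move=> x y e; have xy z : (x < z)%O = (y < z)%O by rewrite -(osuccP x z) e osuccP.
by case: (ltgtP x y) => // [|h]; [rewrite xy ltxx | rewrite -xy ltxx in h].
Qed.

Lemma osupP (X : set omega1) y :
  countable X -> (osup X <= y)%O <-> forall x, X x -> (x <= y)%O.
Proof.
move=> /omega1_bounded[z Xz]; have [|Xs h] := @ominP (ubound X).
  by exists z => x /Xz/ltW.
by split=> [sy x /Xs xs|]; [exact: le_trans sy | exact: h].
Qed.

Section Moduli.
Context {R : realType}.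

Definition nonneg_vec (I : Type) : set {ptws I -> R} :=
  [set delta | forall i, 0 <= delta i].

(* [I = 'I_n] for the [n]-ary moduli and [I = nat] for the [nat]-ary ones; only
   the values on [[0, oo)^I] are relevant. *)
Definition modulus (I : Type) (Delta : {ptws I -> R} -> R) : Prop :=
  [/\ forall d, nonneg_vec d -> 0 <= Delta d,
      Delta (fun=> 0) = 0,
      forall d d', nonneg_vec d -> nonneg_vec d' ->
        Delta d <= Delta (fun i => d i + d' i) <= Delta d + Delta d'
    & {within @nonneg_vec I, continuous Delta}].

Definition weak_modulus (Omega : {ptws nat -> R} -> \bar R) : Prop :=
  [/\ forall d, nonneg_vec d -> (0 <= Omega d)%E,
      Omega (fun=> 0) = 0%E,
      forall d d', nonneg_vec d -> nonneg_vec d' ->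
        (Omega d <= Omega (fun i => d i + d' i)%R <= Omega d + Omega d')%E,
      lower_semicontinuous (Omega : subspace (@nonneg_vec nat) -> \bar R)
    & forall (d : {ptws nat -> R}) (i : nat), nonneg_vec d ->
        {within [set t : R | 0 <= t],
          continuous (fun t => Omega (fun j => if j == i then t else d j))}].

Definition modulus_restr (Omega : {ptws nat -> R} -> \bar R) (n : nat)
    (delta : 'I_n -> R) : \bar R :=
  Omega (fun i => oapp delta 0 (insub i)).

Definition compact_interval (I : set R) : Prop :=
  exists lo hi : R, lo <= hi /\ I = `[lo, hi]%classic.

Definition box (k : nat) (I : 'I_k -> set R) : set {ptws 'I_k -> R} :=
  [set x | forall i, I i (x i)].

Definition conn_modulus (k : nat) (f : {ptws 'I_k -> R} -> R)
    (I : 'I_k -> set R) (delta : 'I_k -> R) : R :=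
  sup [set `|f xy.1 - f xy.2| | xy in
    [set xy : ('I_k -> R) * ('I_k -> R) | [/\ box I xy.1, box I xy.2
      & forall i, `|xy.1 i - xy.2 i| <= delta i]]].

Definition lipschitz1 (k : nat) (f : {ptws 'I_k -> R} -> R) : Prop :=
  forall x y : 'I_k -> R,
    `|f x - f y| <= \big[Num.max/0]_(i < k) `|x i - y i|.

End Moduli.

(* [xpred_sym] lists the predicate symbols other than the distance symbol. *)
Record signature (R : realType) := Signature {
  fun_sym : Type;
  fun_arity : fun_sym -> nat;
  fun_modulus : forall F, ('I_(fun_arity F) -> R) -> R;
  fun_modulusP : forall F, modulus (@fun_modulus F);
  xpred_sym : Type;
  xpred_arity : xpred_sym -> nat;
  xpred_modulus : forall P, ('I_(xpred_arity P) -> R) -> R;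
  xpred_modulusP : forall P, modulus (@xpred_modulus P);
  xpred_bound : xpred_sym -> set R;
  xpred_boundP : forall P, compact_interval (xpred_bound P);
  dist_bound : set R;
  dist_boundP : compact_interval dist_bound
}.

#[short(type="completeMetricType")]
HB.structure Definition CompleteMetric (R : numDomainType) :=
  { M of Complete M & Metric R M }.

Section Signature.
Context {R : realType} (L : signature R).

(* [None] is the distance symbol [d]. *)
Definition pred_sym : Type := option (xpred_sym L).

Definition pred_arity (P : pred_sym) : nat := oapp (@xpred_arity R L) 2 P.

Definition pred_modulus (P : pred_sym) : ('I_(pred_arity P) -> R) -> R :=
  match P return ('I_(pred_arity P) -> R) -> R with
  | Some Q => @xpred_modulus R L Q
  | None => fun delta => delta ord0 + delta ord_max
  end.

Definition pred_bound (P : pred_sym) : set R :=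
  oapp (@xpred_bound R L) (dist_bound L) P.

Definition countable_signature : Prop :=
  countable [set: fun_sym L] /\ countable [set: pred_sym].

(* The library's complete spaces are pointed, so structures are nonempty, as
   usual in logic (the interpretation of [FSup] and [FInf] needs it). *)
Record structure := Structure {
  carrier :> completeMetricType R;
  fun_interp : forall F : fun_sym L, ('I_(fun_arity F) -> carrier) -> carrier;
  fun_interpP : forall F x y,
    mdist (@fun_interp F x) (@fun_interp F y)
      <= fun_modulus (fun i => mdist (x i) (y i));
  xpred_interp : forall P : xpred_sym L, ('I_(xpred_arity P) -> carrier) -> R;
  xpred_interpP : forall P x y,
    `|@xpred_interp P x - @xpred_interp P y|
      <= xpred_modulus (fun i => mdist (x i) (y i));
  xpred_interp_bound : forall P x, xpred_bound P (@xpred_interp P x);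
  dist_interp_bound : forall x y : carrier, dist_bound L (mdist x y)
}.

Definition pred_interp (A : structure) (P : pred_sym) :
    ('I_(pred_arity P) -> A) -> R :=
  match P return ('I_(pred_arity P) -> A) -> R with
  | Some Q => @xpred_interp A Q
  | None => fun x => mdist (x ord0) (x ord_max)
  end.

(* Terms and formulas are scoped: those of type [term n] and [formula n] only
   involve the variables [x_0, ..., x_(n-1)], as free variables, and the
   quantifiers on [formula n.+1] bind [x_n]. *)
Inductive term (n : nat) : Type :=
  | Var of 'I_n
  | App (F : fun_sym L) of 'I_(fun_arity F) -> term n.

Record atom (n : nat) := Atom {
  atom_pred : pred_sym;
  atom_args : 'I_(pred_arity atom_pred) -> term n
}.

#[global] Arguments atom_args [n] a _ : rename.

(* No condition is imposed on the connectives [f] here; these conditions are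
   part of [Omega_bound_formula] below. *)
Inductive formula : nat -> Type :=
  | FAtom n : atom n -> formula n
  | FConn n k (f : {ptws 'I_k -> R} -> R) : ('I_k -> formula n) -> formula n
  | FCSup n : (nat -> formula n) -> formula n
  | FCInf n : (nat -> formula n) -> formula n
  | FSup n : formula n.+1 -> formula n
  | FInf n : formula n.+1 -> formula n.

Fixpoint term_modulus n (t : term n) (delta : 'I_n -> R) : R :=
  match t with
  | Var i => delta i
  | App F ts => fun_modulus (fun i => term_modulus (ts i) delta)
  end.

Definition atom_modulus n (a : atom n) (delta : 'I_n -> R) : R :=
  pred_modulus (fun i => term_modulus (atom_args a i) delta).

Definition basic_formula n m (f : {ptws 'I_m -> R} -> R) (a : 'I_m -> atom n) :
  formula n := FConn f (fun i => FAtom (a i)).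

Definition basic_box n m (a : 'I_m -> atom n) : set {ptws 'I_m -> R} :=
  box (fun i => pred_bound (atom_pred (a i))).

Definition basic_modulus n m (f : {ptws 'I_m -> R} -> R) (a : 'I_m -> atom n)
    (delta : 'I_n -> R) : R :=
  conn_modulus f (fun i => pred_bound (atom_pred (a i)))
    (fun i => atom_modulus (a i) delta).

Definition basic_bound n m (f : {ptws 'I_m -> R} -> R) (a : 'I_m -> atom n) :
  set R := f @` basic_box a.

Definition is_basic n (phi : formula n) : Prop :=
  exists m (f : {ptws 'I_m -> R} -> R) (a : 'I_m -> atom n),
    {within basic_box a, continuous f} /\ phi = basic_formula f a.

Section OmegaFormulas.
Variable Omega : {ptws nat -> R} -> \bar R.

Inductive Omega_bound_formula : forall n, set R -> formula n -> Prop :=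
  | OF_basic n I m (f : {ptws 'I_m -> R} -> R) (a : 'I_m -> atom n) :
      compact_interval I ->
      {within basic_box a, continuous f} ->
      (forall delta : 'I_n -> R, nonneg_vec delta ->
        ((basic_modulus f a delta)%:E <= modulus_restr Omega delta)%E) ->
      basic_bound f a `<=` I ->
      Omega_bound_formula I (basic_formula f a)
  | OF_csup n I (phi : nat -> formula n) :
      (forall i, Omega_bound_formula I (phi i)) ->
      Omega_bound_formula I (FCSup phi)
  | OF_cinf n I (phi : nat -> formula n) :
      (forall i, Omega_bound_formula I (phi i)) ->
      Omega_bound_formula I (FCInf phi)
  | OF_sup n I (phi : formula n.+1) :
      Omega_bound_formula I phi -> Omega_bound_formula I (FSup phi)
  | OF_inf n I (phi : formula n.+1) :
      Omega_bound_formula I phi -> Omega_bound_formula I (FInf phi)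
  | OF_conn n I J k (f : {ptws 'I_k -> R} -> R) (phi : 'I_k -> formula n) :
      compact_interval I ->
      (forall i, Omega_bound_formula I (phi i)) ->
      lipschitz1 f ->
      J = f @` box (fun=> I) ->
      Omega_bound_formula J (FConn f phi).

Definition Omega_formula n (phi : formula n) : Prop :=
  exists I, compact_interval I /\ Omega_bound_formula I phi.

End OmegaFormulas.

Fixpoint qr n (phi : formula n) : omega1 :=
  match phi with
  | FAtom _ _ => ozero
  | FConn _ _ _ phis => osup (range (fun i => qr (phis i)))
  | FCSup _ phis => osup (range (fun i => qr (phis i)))
  | FCInf _ phis => osup (range (fun i => qr (phis i)))
  | FSup _ psi => osucc (qr psi)
  | FInf _ psi => osucc (qr psi)
  end.

Fixpoint term_interp (A : structure) n (t : term n) (a : 'I_n -> A) : A :=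
  match t with
  | Var i => a i
  | App F ts => fun_interp (fun i => term_interp (ts i) a)
  end.

Definition snoc (T : Type) n (a : 'I_n -> T) (c : T) (i : 'I_n.+1) : T :=
  oapp a c (unlift ord_max i).

Fixpoint interp (A : structure) n (phi : formula n) : ('I_n -> A) -> R :=
  match phi in formula n return ('I_n -> A) -> R with
  | FAtom _ p => fun a =>
      pred_interp (fun i => term_interp (atom_args p i) a)
  | FConn _ _ f phis => fun a => f (fun i => interp (phis i) a)
  | FCSup _ phis => fun a => sup (range (fun i => interp (phis i) a))
  | FCInf _ phis => fun a => inf (range (fun i => interp (phis i) a))
  | FSup _ psi => fun a => sup (range (fun c => interp psi (snoc a c)))
  | FInf _ psi => fun a => inf (range (fun c => interp psi (snoc a c)))
  end.

Section BackAndForth.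
Variables (Omega : {ptws nat -> R} -> \bar R) (A B : structure).

Definition bf_fun : Type :=
  forall n, ('I_n -> A) -> ('I_n -> B) -> \bar R.

Definition bf_zero : bf_fun := fun n a b =>
  ereal_sup [set `|interp phi a - interp phi b|%:E | phi in
    [set phi : formula n | is_basic phi /\ Omega_formula Omega phi]].

Definition bf_next (r : bf_fun) : bf_fun := fun n a b =>
  ereal_sup [set ereal_inf
      [set maxe (r n.+1 (snoc a cd.1) (snoc b cd'.2))
                (r n.+1 (snoc a cd'.1) (snoc b cd.2))
        | cd' in [set: A * B]]
    | cd in [set: A * B]].

Definition bf_step (alpha : omega1)
    (r : forall beta : omega1, (beta < alpha)%O -> bf_fun) : bf_fun :=
  if pselect (alpha = ozero) then bf_zero
  else if pselect (exists beta, alpha = osucc beta) is left succ_alpha then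
    let beta := cid succ_alpha in
    bf_next (r (sval beta)
      (eq_ind_r (fun x => (sval beta < x)%O) (ltosucc (sval beta)) (svalP beta)))
  else fun n a b =>
    ereal_sup [set e | exists beta (lt_beta : (beta < alpha)%O),
                         e = r beta lt_beta n a b].

Definition bf_dist : omega1 -> bf_fun := Fix omega1_wf (fun=> bf_fun) bf_step.

Lemma bf_distE alpha : bf_dist alpha = @bf_step alpha (fun beta _ => bf_dist beta).
Proof.
apply: Fix_eq => x f g fg; congr bf_step.
by apply/functional_extensionality_dep => y; apply/functional_extensionality_dep.
Qed.

Lemma bf_dist0 : bf_dist ozero = bf_zero.
Proof. by rewrite bf_distE /bf_step; case: pselect. Qed.

Lemma bf_distS alpha : bf_dist (osucc alpha) = bf_next (bf_dist alpha).
Proof.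
rewrite bf_distE /bf_step; case: pselect => [/= s0|_ /=].
  by have := ozero_le alpha; rewrite leNgt -s0 ltosucc.
case: pselect => [/= h|[]]; last by exists alpha.
by congr (bf_next (bf_dist _)); case: cid => /= beta /osucc_inj.
Qed.

Lemma bf_dist_lim alpha n (a : 'I_n -> A) (b : 'I_n -> B) :
  alpha <> ozero -> (forall beta, alpha <> osucc beta) ->
  bf_dist alpha a b =
  ereal_sup [set bf_dist beta a b | beta in [set beta | (beta < alpha)%O]].
Proof.
move=> n0 nS; rewrite bf_distE /bf_step; case: pselect => //= _.
case: pselect => [/= h|/= _]; first by exfalso; case: h => beta /nS.
congr ereal_sup; apply/seteqP; split => e [beta].
  by move=> [lt_beta ->]; exists beta.
by move=> lt_beta <-; exists beta, lt_beta.
Qed.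

End BackAndForth.

End Signature.

Definition separable (T : topologicalType) : Prop :=
  exists D : set T, countable D /\ dense D.

(* Main.v *)
Require Import Defs.
From mathcomp Require Import all_boot all_order all_algebra.
From mathcomp Require Import all_classical all_reals all_analysis.
From mathcomp Require Import lra.

(* Formulas are bounded by [r_alpha] by induction on formulas, once [r_alpha] is
   known to increase with [alpha].  Variables cannot be permuted or inserted, as
   [Omega] is not symmetric; adding a last dummy variable is harmless and gives
   [r_0 <= r_1], and the monotonicity of the back-and-forth step propagates this
   to all ordinals.
   Conversely, if [0 < t < r_(alpha+1)(A a, B b)] then, up to exchanging [A] and
   [B], some [c] in [A] satisfies [r_alpha(A a c, B b d) > t] for all [d] in [B].
   By induction there are formulas [phi_k] whose values at [a c] and at [b d_k]
   differ by more than [t], with [d_k] ranging over a dense sequence.  The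
   formulas [psi_k = min(|phi_k - phi_k(a c)|, t)] vanish at [a c] and equal [t]
   at [b d_k], so [inf_x \/_k psi_k] is [0] at [a]; it is [t] at [b] because the
   [psi_k] share a modulus of continuity in [x]. *)

Set Implicit Arguments.
Unset Strict Implicit.
Unset Printing Implicit Defensive.

Import Order.TTheory GRing.Theory Num.Theory.
Import numFieldNormedType.Exports.

Local Open Scope classical_set_scope.
Local Open Scope ring_scope.

Lemma countable_range (T : countType) (U : Type) (f : T -> U) :
  countable (range f).
Proof. exact: card_le_trans (card_image_le f _) (countableP _). Qed.

(** * Comparison of suprema and infima of families of reals *)

Section SupInf.
Context {R : realType} (T U : Type).
Implicit Types (F : T -> R) (G : U -> R) (e : R).

Lemma sup_range_le F G e : T -> has_ubound (range G) ->
  (forall x eps, 0 < eps -> exists y, F x <= G y + e + eps) ->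
  sup (range F) <= sup (range G) + e.
Proof.
move=> x0 Gub FG; apply: ge_sup; first by exists (F x0), x0.
move=> _ [x _ <-]; apply/ler_addgt0Pr => eps eps0.
have [y Fxy] := FG x _ eps0.
by rewrite (le_trans Fxy)// !lerD2r; apply: ub_le_sup => //; exists y.
Qed.

Lemma inf_range_le F G e : U -> has_lbound (range F) ->
  (forall y eps, 0 < eps -> exists x, F x <= G y + e + eps) ->
  inf (range F) <= inf (range G) + e.
Proof.
move=> y0 Flb FG; rewrite -lerBlDr; apply: lb_le_inf; first by exists (G y0), y0.
move=> _ [y _ <-]; rewrite lerBlDr; apply/ler_addgt0Pr => eps eps0.
have [x Fxy] := FG y _ eps0.
by rewrite (le_trans _ Fxy)//; apply: ge_inf => //; exists x.
Qed.

End SupInf.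

Section IntervalValued.
Context {R : realType} (T : Type).
Implicit Types (F : T -> R) (I : set R).

Lemma range_bounded F I : compact_interval I -> (forall x, I (F x)) ->
  has_ubound (range F) /\ has_lbound (range F).
Proof.
move=> [lo [hi [_ ->]]] FI; split.
  by exists hi => _ [x _ <-]; have := FI x; rewrite /= in_itv/= => /andP[].
by exists lo => _ [x _ <-]; have := FI x; rewrite /= in_itv/= => /andP[].
Qed.

Lemma sup_in_interval F I : T -> compact_interval I -> (forall x, I (F x)) ->
  I (sup (range F)) /\ I (inf (range F)).
Proof.
move=> x0 cI FI; have [Fu Fl] := range_bounded cI FI.
move: cI FI => [lo [hi [_ ->]]] FI.
have {}FI x : lo <= F x <= hi by have := FI x; rewrite /= in_itv.
have ne : range F !=set0 by exists (F x0), x0.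
split; rewrite /= in_itv/=; apply/andP; split.
- apply: (le_trans (proj1 (andP (FI x0)))).
  by apply: ub_le_sup => //; exists x0.
- by apply: ge_sup => // _ [x _ <-]; case/andP: (FI x).
- by apply: lb_le_inf => // _ [x _ <-]; case/andP: (FI x).
- apply: (le_trans _ (proj2 (andP (FI x0)))).
  by apply: ge_inf => //; exists x0.
Qed.

End IntervalValued.

(** The values are matched only up to every [eps], because the infimum in [bf_next] need not be
    attained. The bound [e] is extended, as back-and-forth distances may be infinite. *)
Lemma sup_inf_range_dist {R : realType} (T U : Type) (F : T -> R) (G : U -> R)
    (I : set R) (e : \bar R) : T -> U -> compact_interval I ->
  (forall x, I (F x)) -> (forall y, I (G y)) ->
  (forall x (eps : R), 0 < eps ->
    exists y, (`|F x - G y|%:E <= e + eps%:E)%E) ->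
  (forall y (eps : R), 0 < eps ->
    exists x, (`|F x - G y|%:E <= e + eps%:E)%E) ->
  (`|sup (range F) - sup (range G)|%:E <= e)%E /\
  (`|inf (range F) - inf (range G)|%:E <= e)%E.
Proof.
move=> x0 y0 cI FI GI; case: e => [e| |] FG GF; last 2 first.
- by rewrite !leey.
(* For [e = -oo] the matching of [x0] is already absurd. *)
- by have [y] := FG x0 1 ltr01.
rewrite !lee_fin.
have [Fu Fl] := range_bounded cI FI; have [Gu Gl] := range_bounded cI GI.
have FG' x eps : 0 < eps ->
    exists y, F x <= G y + e + eps /\ G y <= F x + e + eps.
  move=> /(FG x)[y]; rewrite -EFinD lee_fin ler_norml => /andP[? ?].
  by exists y; split; lra.
have GF' y eps : 0 < eps ->
    exists x, F x <= G y + e + eps /\ G y <= F x + e + eps.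
  move=> /(GF y)[x]; rewrite -EFinD lee_fin ler_norml => /andP[? ?].
  by exists x; split; lra.
have s1 : sup (range F) <= sup (range G) + e.
  by apply: sup_range_le => // x eps /(FG' x)[y []]; exists y.
have s2 : sup (range G) <= sup (range F) + e.
  by apply: sup_range_le => // y eps /(GF' y)[x []]; exists x.
have i1 : inf (range F) <= inf (range G) + e.
  by apply: inf_range_le => // y eps /(GF' y)[x []]; exists x.
have i2 : inf (range G) <= inf (range F) + e.
  by apply: inf_range_le => // x eps /(FG' x)[y []]; exists y.
by rewrite !ler_norml; split; lra.
Qed.

Lemma sup_inf_pointwise_dist {R : realType} (T : Type) (F G : T -> R)
    (I : set R) (e : \bar R) : T -> compact_interval I ->
  (forall x, I (F x)) -> (forall x, I (G x)) ->
  (forall x, (`|F x - G x|%:E <= e)%E) ->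
  (`|sup (range F) - sup (range G)|%:E <= e)%E /\
  (`|inf (range F) - inf (range G)|%:E <= e)%E.
Proof.
move=> x0 cI FI GI FG.
by apply: sup_inf_range_dist (x0) (x0) cI FI GI _ _ => x eps eps0; exists x;
  rewrite (le_trans (FG x))// leeDl// lee_fin ltW.
Qed.

(** * Weak moduli and their restrictions to finitely many variables *)

Section ModulusTheory.
Context {R : realType}.

Lemma modulus_le (I : Type) (Delta : {ptws I -> R} -> R) (d d' : I -> R) :
  modulus Delta -> nonneg_vec d -> (forall i, d i <= d' i) ->
  Delta d <= Delta d'.
Proof.
move=> [_ _ h _] d0 dd'.
have d'd0 : nonneg_vec (fun i => d' i - d i) by move=> i; rewrite subr_ge0.
have := proj1 (andP (h _ _ d0 d'd0)); rewrite (_ : (fun i => _) = d')//.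
by apply/funext => i; rewrite addrC subrK.
Qed.

Variable Omega : {ptws nat -> R} -> \bar R.
Hypothesis OmegaP : weak_modulus Omega.

Lemma weak_modulus_le (d d' : nat -> R) :
  nonneg_vec d -> (forall i, d i <= d' i) -> (Omega d <= Omega d')%E.
Proof.
move: OmegaP => [_ _ h _ _] d0 dd'.
have d'd0 : nonneg_vec (fun i => d' i - d i) by move=> i; rewrite subr_ge0.
have := proj1 (andP (h _ _ d0 d'd0)); rewrite (_ : (fun i => _) = d')//.
by apply/funext => i; rewrite addrC subrK.
Qed.

Lemma modulus_restr_ge0 n (d : 'I_n -> R) :
  nonneg_vec d -> (0 <= modulus_restr Omega d)%E.
Proof.
move=> d0; case: OmegaP => + _ _ _ _; apply => i /=.
by case: insub => //= j; exact: d0.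
Qed.

Lemma oapp_insub_ord_lt n (d : 'I_n -> R) (i : nat) (ilt : (i < n)%N) :
  oapp d 0 (insub i) = d (Ordinal ilt).
Proof. by rewrite insubT. Qed.

(** Dropping the last coordinate and padding with zeros amounts to lowering that coordinate to [0],
    so monotonicity of [Omega] applies. *)
Lemma modulus_restr_lift n (d : 'I_n.+1 -> R) : nonneg_vec d ->
  (modulus_restr Omega (fun i : 'I_n => d (lift ord_max i))
     <= modulus_restr Omega d)%E.
Proof.
move=> d0; apply: weak_modulus_le => i /=.
  by case: insub => //= j; exact: d0.
case: insubP => /= [j ltin ji|nltin].
  rewrite (oapp_insub_ord_lt _ (ltnW ltin : (i < n.+1)%N)).
  rewrite le_eqVlt; apply/orP; left; apply/eqP; congr d.
  by apply: val_inj; rewrite /= /bump leqNgt ltn_ord.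
by case: insub => //= j; exact: d0.
Qed.

(** The appended [0] coincides with the padding. This serves for quantifiers: a bound variable kept
    in place adds a last distance [0]. *)
Lemma modulus_restr_snoc n (d : 'I_n -> R) :
  modulus_restr Omega (snoc d 0) = modulus_restr Omega d.
Proof.
congr Omega; apply/funext => i.
case: (ltngtP i n) => [ltin|ltni|->].
- rewrite (oapp_insub_ord_lt _ (ltnW ltin : (i < n.+1)%N)).
  rewrite (oapp_insub_ord_lt _ ltin).
  rewrite /snoc; have -> : Ordinal (ltnW ltin : (i < n.+1)%N) =
      lift ord_max (Ordinal ltin).
    by apply: val_inj; rewrite /= /bump leqNgt ltin.
  by rewrite liftK.
- by rewrite !insubF//; apply/negbTE; rewrite -leqNgt// ltnW.
- rewrite (oapp_insub_ord_lt _ (ltnSn n)) insubF ?ltnn// /snoc.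
  by rewrite (_ : Ordinal _ = ord_max) ?unlift_none//; exact: val_inj.
Qed.

(** This is continuity of [Omega] in its argument number [n] at the zero sequence, where [Omega]
    vanishes. It gives all [Omega]-formulas a common modulus of continuity in their last
    variable. *)
Lemma modulus_restr_last_small n (eps : R) : 0 < eps ->
  exists2 eta : R, 0 < eta & forall t : R, 0 <= t -> t < eta ->
    (modulus_restr Omega (snoc (fun _ : 'I_n => 0%R) t) < eps%:E)%E.
Proof.
move=> eps0; case: OmegaP => _ Om0 _ _ /(_ (fun=> 0) n (fun=> lexx 0)).
move=> /subspace_continuousP/(_ 0 (lexx 0)) Omc.
have nb : nbhs (Omega (fun j => if j == n then 0 else 0))
    [set u | (u < eps%:E)%E].
  rewrite (_ : (fun j => _) = fun=> 0) ?Om0; last by apply/funext => j; case: eqP.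
  apply: open_nbhs_nbhs; split; first exact: open_ereal_lt_ereal.
  by rewrite /= lte_fin.
have /nbhs_ballP[eta eta0 etaP] := Omc _ nb.
exists eta => // t t0 teta.
have := etaP t; rewrite /ball/= sub0r normrN ger0_norm//.
move=> /(_ teta t0); rewrite /modulus_restr.
suff -> : (fun i => oapp (snoc (fun _ : 'I_n => 0) t) 0 (insub i)) =
    (fun j => if j == n then t else 0) by [].
apply/funext => i.
case: (ltngtP i n) => [ltin|ltni|->].
- rewrite (oapp_insub_ord_lt _ (ltnW ltin : (i < n.+1)%N)) /snoc.
  by case: unliftP => //= /(congr1 val)/= ein; rewrite ein ltnn in ltin.
- by rewrite insubF//; apply/negbTE; rewrite -leqNgt.
- rewrite (oapp_insub_ord_lt _ (ltnSn n)) /snoc.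
  by rewrite (_ : Ordinal _ = ord_max) ?unlift_none//; exact: val_inj.
Qed.

End ModulusTheory.

(** * Interpretations respect bounds and moduli *)

Section Formulas.
Context {R : realType} (L : signature R).

Lemma term_interp_dist (A : structure L) n (t : term L n) (a b : 'I_n -> A) :
  mdist (term_interp t a) (term_interp t b)
    <= term_modulus t (fun i => mdist (a i) (b i)).
Proof.
elim: t => [i|F ts IH] //=; apply: (le_trans (fun_interpP _ _)).
by apply: (modulus_le (fun_modulusP F)) => // i; exact: mdist_ge0.
Qed.

Lemma pred_interp_dist (A : structure L) (P : pred_sym L)
    (x y : 'I_(pred_arity P) -> A) (d : 'I_(pred_arity P) -> R) :
  (forall i, mdist (x i) (y i) <= d i) ->
  `|pred_interp x - pred_interp y| <= pred_modulus d.
Proof.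
case: P x y d => [P|] /= x y d xyd.
  apply: (le_trans (xpred_interpP _ _)).
  by apply: (modulus_le (xpred_modulusP P)) => // i; exact: mdist_ge0.
(* For the distance symbol this is the quadrilateral inequality, from four triangle inequalities. *)
apply: (le_trans _ (lerD (xyd ord0) (xyd ord_max))).
have := metric_triangle (x ord0) (y ord0) (x ord_max).
have := metric_triangle (y ord0) (y ord_max) (x ord_max).
have := metric_triangle (y ord0) (x ord0) (y ord_max).
have := metric_triangle (x ord0) (x ord_max) (y ord_max).
rewrite (metric_sym (y ord0) (x ord0)) (metric_sym (y ord_max) (x ord_max)).
by rewrite ler_norml; lra.
Qed.

Lemma pred_boundP (P : pred_sym L) : compact_interval (pred_bound P).
Proof. by case: P => [P|]; [exact: xpred_boundP | exact: dist_boundP]. Qed.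

Lemma pred_interp_bound (A : structure L) (P : pred_sym L)
  (x : 'I_(pred_arity P) -> A) : pred_bound P (pred_interp x).
Proof.
by case: P x => [P|] x; [exact: xpred_interp_bound | exact: dist_interp_bound].
Qed.

(** The supremum in [conn_modulus] must be that of a bounded set: the box is compact by Tychonoff,
    so [f] is bounded on it. *)
Lemma conn_modulus_ge k (f : {ptws 'I_k -> R} -> R) (I : 'I_k -> set R)
    (d x y : 'I_k -> R) :
  (forall i, compact_interval (I i)) -> {within box I, continuous f} ->
  box I x -> box I y -> (forall i, `|x i - y i| <= d i) ->
  `|f x - f y| <= conn_modulus f I d.
Proof.
move=> cI fc Ix Iy xyd; apply: ub_le_sup; last by exists (x, y).
have : compact (f @` box I).
  apply: continuous_compact => //; apply: tychonoff => i.
  by have [lo [hi [_ ->]]] := cI i; exact: segment_compact.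
move=> /compact_bounded[M [_ Mb]].
exists ((M + 1) + (M + 1)) => _ [[u v] [/= Iu Iv _] <-].
apply: (le_trans (ler_normB _ _)).
have fM w : box I w -> `|f w| <= M + 1.
  by move=> Iw; apply: (Mb (M + 1)); [rewrite ltrDl | exists w].
by apply: lerD; exact: fM.
Qed.

Variable Omega : {ptws nat -> R} -> \bar R.
Hypothesis OmegaP : weak_modulus Omega.

Lemma Omega_bound_interp (A : structure L) n I (phi : formula L n)
    (a : 'I_n -> A) :
  Omega_bound_formula Omega I phi -> compact_interval I -> I (interp phi a).
Proof.
move=> Hphi; elim: Hphi a => {n I phi} /=.
- move=> n I m f p cI fc _ fI a _; apply: fI.
  exists (fun i => interp (FAtom (p i)) a) => //.
  by move=> i /=; exact: pred_interp_bound.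
- move=> n I phi _ IH a cI; apply: (proj1 (sup_in_interval 0%N cI _)) => i.
  exact: IH.
- move=> n I phi _ IH a cI; apply: (proj2 (sup_in_interval 0%N cI _)) => i.
  exact: IH.
(* The default [point] of the carrier makes the range nonempty, so [sup] is a true supremum. *)
- move=> n I phi _ IH a cI; apply: (proj1 (sup_in_interval (point : A) cI _)) => c.
  exact: IH.
- move=> n I phi _ IH a cI; apply: (proj2 (sup_in_interval (point : A) cI _)) => c.
  exact: IH.
- move=> n I J k f phi cI _ IH fl -> a _; exists (fun i => interp (phi i) a) => //.
  by move=> i; exact: IH.
Qed.

(** The assumption [0 <= e] covers [k = 0], where the maximum is [0]. *)
Lemma lipschitz1_le k (f : {ptws 'I_k -> R} -> R) (x y : 'I_k -> R)
    (e : \bar R) :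
  lipschitz1 f -> (0 <= e)%E -> (forall i, (`|x i - y i|%:E <= e)%E) ->
  (`|f x - f y|%:E <= e)%E.
Proof.
move=> fl; case: e => [e| |] // e0 xye; last by rewrite leey.
by rewrite lee_fin; apply: (le_trans (fl x y)); apply: bigmax_le => [|i _];
  rewrite -lee_fin.
Qed.

Lemma snoc_mdist (A : structure L) n (a b : 'I_n -> A) (c c' : A) :
  (fun i => mdist (snoc a c i) (snoc b c' i)) =
  snoc (fun i => mdist (a i) (b i)) (mdist c c').
Proof. by apply/funext => i; rewrite /snoc; case: unliftP. Qed.

(** Suprema, infima and 1-Lipschitz connectives preserve a common modulus. At a quantifier both
    sides are compared at the same value of the bound variable. *)
Lemma Omega_bound_interp_dist (A : structure L) n I (phi : formula L n)
    (a b : 'I_n -> A) :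
  Omega_bound_formula Omega I phi -> compact_interval I ->
  (`|interp phi a - interp phi b|%:E
     <= modulus_restr Omega (fun i => mdist (a i) (b i)))%E.
Proof.
move=> Hphi; elim: Hphi a b => {n I phi}.
- move=> n I m f p cI fc fO fI a b _.
  have d0 : nonneg_vec (fun i => mdist (a i) (b i)) by move=> i; exact: mdist_ge0.
  apply: le_trans (fO _ d0); rewrite lee_fin; apply: conn_modulus_ge => //.
  + by move=> i; exact: pred_boundP.
  + by move=> i; exact: pred_interp_bound.
  + by move=> i; exact: pred_interp_bound.
  + by move=> i; apply: pred_interp_dist => j; exact: term_interp_dist.
- move=> n I phi Hphi IH a b cI.
  apply: (proj1 (sup_inf_pointwise_dist 0%N cI _ _ _)) => i.
  + exact: Omega_bound_interp.
  + exact: Omega_bound_interp.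
  + exact: IH.
- move=> n I phi Hphi IH a b cI.
  apply: (proj2 (sup_inf_pointwise_dist 0%N cI _ _ _)) => i.
  + exact: Omega_bound_interp.
  + exact: Omega_bound_interp.
  + exact: IH.
- move=> n I phi Hphi IH a b cI.
  apply: (proj1 (sup_inf_pointwise_dist (point : A) cI _ _ _)) => i.
  + exact: Omega_bound_interp.
  + exact: Omega_bound_interp.
  + by rewrite (le_trans (IH _ _ cI))// snoc_mdist mdistxx modulus_restr_snoc.
- move=> n I phi Hphi IH a b cI.
  apply: (proj2 (sup_inf_pointwise_dist (point : A) cI _ _ _)) => i.
  + exact: Omega_bound_interp.
  + exact: Omega_bound_interp.
  + by rewrite (le_trans (IH _ _ cI))// snoc_mdist mdistxx modulus_restr_snoc.
- move=> n I J k f phi cI _ IH fl _ a b _; apply: lipschitz1_le => // [|i].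
    by apply: modulus_restr_ge0 => // i; exact: mdist_ge0.
  exact: IH.
Qed.

(** Without arguments the last rule asks nothing of subformulas. The arity is assumed equal to [0],
    rather than written so, to suit a variable [m] known to vanish. *)
Lemma const_Omega_formula n k (f : {ptws 'I_k -> R} -> R)
    (phi : 'I_k -> formula L n) :
  k = 0%N -> Omega_formula Omega (FConn f phi).
Proof.
move=> k0; have no (i : 'I_k) : False by move: i; rewrite k0 => -[].
pose x0 : 'I_k -> R := fun=> 0.
have x0E (x : 'I_k -> R) : x = x0 by apply/funext => i; case: (no i).
have fE (x : 'I_k -> R) : f x = f x0 by rewrite [x]x0E.
exists `[f x0, f x0]%classic; split; first by exists (f x0), (f x0).
(* The interval [[0, 0]] is an arbitrary choice, as no argument has to lie in it. *)
apply: (@OF_conn _ _ _ _ `[0, 0]%classic) => //.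
- by exists 0, 0.
- by move=> x y; rewrite (fE x) (fE y) subrr normr0; apply: bigmax_ge_id.
- rewrite set_itv1; apply/seteqP; split => [_ ->|_ [x _ <-]]; last exact: fE.
  by exists x0 => // i; case: (no i).
Qed.

(** * Adding a dummy last variable *)

Fixpoint term_widen n (t : term L n) : term L n.+1 :=
  match t with
  | Var i => Var L (lift ord_max i)
  | App F ts => App (fun i => term_widen (ts i))
  end.

Definition atom_widen n (p : atom L n) : atom L n.+1 :=
  Atom (fun i => term_widen (atom_args p i)).

Lemma term_widen_interp (A : structure L) n (t : term L n) (a : 'I_n -> A) c :
  term_interp (term_widen t) (snoc a c) = term_interp t a.
Proof.
elim: t => [i|F ts IH] /=; first by rewrite /snoc liftK.
by congr fun_interp; apply/funext => i.
Qed.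

Lemma term_widen_modulus n (t : term L n) (d : 'I_n.+1 -> R) :
  term_modulus (term_widen t) d = term_modulus t (fun i => d (lift ord_max i)).
Proof.
by elim: t => [i|F ts IH] //=; congr fun_modulus; apply/funext => i.
Qed.

Lemma atom_widen_modulus n (p : atom L n) (d : 'I_n.+1 -> R) :
  atom_modulus (atom_widen p) d = atom_modulus p (fun i => d (lift ord_max i)).
Proof.
rewrite /atom_modulus /=; congr pred_modulus; apply/funext => i.
exact: term_widen_modulus.
Qed.

Lemma interp_basic_widen (A : structure L) n m (f : {ptws 'I_m -> R} -> R)
    (p : 'I_m -> atom L n) (a : 'I_n -> A) c :
  interp (basic_formula f (fun i => atom_widen (p i))) (snoc a c) =
  interp (basic_formula f p) a.
Proof.
rewrite /=; congr (f _); apply/funext => i; congr pred_interp.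
by apply/funext => j; exact: term_widen_interp.
Qed.

(** A projection for the injectivity of [FAtom]; on the indexed type [formula], inversion would only
    give an equality of dependent pairs. *)
Definition formula_atom n (phi : formula L n) : option (atom L n) :=
  match phi in formula _ n return option (atom L n) with
  | FAtom _ p => Some p
  | _ => None
  end.

Definition basic_conditions n m (f : {ptws 'I_m -> R} -> R)
    (p : 'I_m -> atom L n) (I : set R) : Prop :=
  [/\ compact_interval I,
    {within basic_box p, continuous f},
    forall delta : 'I_n -> R, nonneg_vec delta ->
      ((basic_modulus f p delta)%:E <= modulus_restr Omega delta)%E
    & basic_bound f p `<=` I].

(* A bare atom is never an [(Omega, I)]-formula; hence a basic formula is one
   either by the first rule or, without atoms, by the last one. *)
Lemma Omega_basicP n m (f : {ptws 'I_m -> R} -> R) (p : 'I_m -> atom L n) :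
  Omega_formula Omega (basic_formula f p) ->
  m = 0%N \/ exists I, basic_conditions f p I.
Proof.
(* [inv] states the conclusion for any formula, so that the induction needs no fixed shape of
   [phi]. *)
pose inv n (phi : formula L n) := match phi return Prop with
  | FAtom _ _ => False
  | FConn n m f phis => forall p : 'I_m -> atom L n,
      phis = (fun i => FAtom (p i)) -> m = 0%N \/ exists I, basic_conditions f p I
  | _ => True end.
suff H I (phi : formula L n) : Omega_bound_formula Omega I phi -> inv n phi.
  by move=> [I [_ /H/(_ p)]]; exact.
elim => {n m f p I phi} //=.
- move=> n I m f p cI fc fO fI q pq; right; exists I.
  suff <- : p = q by [].
  apply/funext => i; suff : Some (p i) = Some (q i) by case.
  rewrite -[LHS]/(formula_atom (FAtom (p i))).
  by rewrite -[RHS]/(formula_atom (FAtom (q i))) (congr1 (fun h => h i) pq).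
(* With at least one argument, the induction hypothesis at the first one, an atom, is [False]. *)
- move=> n I J [|k] f phi _ _ IH _ _ p phiE; first by left.
  by have := IH ord0; rewrite phiE.
Qed.

(** The widened formula has the old modulus, evaluated without the last coordinate, and
    [modulus_restr_lift] absorbs the change. *)
Lemma Omega_basic_widen n m (f : {ptws 'I_m -> R} -> R) (p : 'I_m -> atom L n) :
  Omega_formula Omega (basic_formula f p) ->
  Omega_formula Omega (basic_formula f (fun i => atom_widen (p i))).
Proof.
move=> /Omega_basicP[m0|[I [cI fc fO fI]]]; first exact: const_Omega_formula.
exists I; split=> //; apply: OF_basic => // d d0.
apply: le_trans (modulus_restr_lift OmegaP d0).
apply: le_trans (fO _ _); last by move=> i; exact: d0.
rewrite lee_fin le_eqVlt; apply/orP; left; apply/eqP.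
rewrite /basic_modulus; congr conn_modulus; apply/funext => i.
exact: atom_widen_modulus.
Qed.

(** * Monotonicity of the back-and-forth distances and the bound on formulas *)

Section BackForth.
Variables A B : structure L.
Implicit Types r : bf_fun A B.

(** The constant [0], as a connective without atoms, takes part in the supremum. *)
Lemma bf_zero_ge0 n (a : 'I_n -> A) (b : 'I_n -> B) : (0 <= bf_zero Omega a b)%E.
Proof.
have no (i : 'I_0) : atom L n by case: i.
apply: le_ereal_sup_tmp; exists 0%E => //.
exists (basic_formula (fun=> 0) no); last by rewrite /= subrr normr0.
split; last exact: const_Omega_formula.
exists 0%N, (fun=> 0), no; split => //.
apply: continuous_subspaceT; exact: (@cst_continuous {ptws 'I_0 -> R} R 0).
Qed.

Lemma bf_zero_snoc n (a : 'I_n -> A) (b : 'I_n -> B) c d :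
  (bf_zero Omega a b <= bf_zero Omega (snoc a c) (snoc b d))%E.
Proof.
apply: ge_ereal_sup => _ [phi [[m [f [p [fc ->]]]] phiO] <-].
apply: ereal_sup_ubound; exists (basic_formula f (fun i => atom_widen (p i))).
  split; last exact: Omega_basic_widen.
  by exists m, f, (fun i => atom_widen (p i)).
by rewrite !interp_basic_widen.
Qed.

Lemma bf_next_le r r' :
  (forall n (a : 'I_n -> A) (b : 'I_n -> B), (r n a b <= r' n a b)%E) ->
  forall n (a : 'I_n -> A) (b : 'I_n -> B), (bf_next r a b <= bf_next r' a b)%E.
Proof.
move=> rr' n a b; apply: ge_ereal_sup => _ [cd _ <-].
apply: le_ereal_sup_tmp; eexists; first by exists cd.
apply: le_ereal_inf_tmp => _ [cd' _ <-].
apply: ge_ereal_inf; eexists; first by exists cd'.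
by rewrite ge_max !le_max !rr' orbT.
Qed.

Lemma bf_dist_le_next alpha n (a : 'I_n -> A) (b : 'I_n -> B) :
  (bf_dist Omega alpha a b <= bf_next (bf_dist Omega alpha) a b)%E.
Proof.
elim/(well_founded_ind omega1_wf): alpha n a b => alpha IH n a b.
have [->|n0] := pselect (alpha = ozero).
  rewrite bf_dist0; apply: le_ereal_sup_tmp; eexists.
    (* Any challenge will do, since [bf_zero_snoc] holds for all extensions. *)
    by exists (point, point).
  apply: le_ereal_inf_tmp => _ [cd' _ <-].
  by rewrite le_max bf_zero_snoc.
have [[beta alphaE]|nS] := pselect (exists beta, alpha = osucc beta).
  rewrite alphaE bf_distS; apply: bf_next_le => k a' b'.
  by apply: IH; rewrite alphaE ltosucc.
rewrite bf_dist_lim//; last by move=> beta E; apply: nS; exists beta.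
(* For [beta] below the limit [alpha], [r_beta <= bf_next r_beta <= bf_next r_alpha]. *)
apply: ge_ereal_sup => _ [beta beta_lt <-].
apply: (le_trans (IH _ beta_lt _ _ _)).
apply: bf_next_le => k a' b'; rewrite (@bf_dist_lim _ _ _ _ _ alpha)//.
  by apply: ereal_sup_ubound; exists beta.
by move=> gamma E; apply: nS; exists gamma.
Qed.

Lemma bf_dist_le beta alpha n (a : 'I_n -> A) (b : 'I_n -> B) :
  (beta <= alpha)%O -> (bf_dist Omega beta a b <= bf_dist Omega alpha a b)%E.
Proof.
elim/(well_founded_ind omega1_wf): alpha beta => alpha IH beta.
rewrite le_eqVlt => /orP[/eqP -> //|beta_lt].
have [alphaE|n0] := pselect (alpha = ozero).
  by move: beta_lt; rewrite alphaE ltNge ozero_le.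
have [[gamma alphaE]|nS] := pselect (exists gamma, alpha = osucc gamma).
  apply: (@le_trans _ _ (bf_dist Omega gamma a b)).
    apply: IH; first by rewrite alphaE ltosucc.
    by rewrite leNgt -osuccP -ltNge -alphaE.
  by rewrite alphaE bf_distS; exact: bf_dist_le_next.
rewrite (@bf_dist_lim _ _ _ _ _ alpha)//.
  by apply: ereal_sup_ubound; exists beta.
by move=> gamma E; apply: nS; exists gamma.
Qed.

Lemma bf_dist_ge0 alpha n (a : 'I_n -> A) (b : 'I_n -> B) :
  (0 <= bf_dist Omega alpha a b)%E.
Proof.
apply: le_trans (bf_dist_le a b (ozero_le alpha)); rewrite bf_dist0.
exact: bf_zero_ge0.
Qed.

(** In [bf_next] a challenge consists of [c] and [d] together; setting one of them to [point]
    isolates the forth or the back condition. *)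
Lemma bf_next_extend r n (a : 'I_n -> A) (b : 'I_n -> B) (eps : R) :
  (0 <= bf_next r a b)%E -> 0 < eps ->
  (forall c, exists d,
    (r n.+1 (snoc a c) (snoc b d) <= bf_next r a b + eps%:E)%E) /\
  (forall d, exists c,
    (r n.+1 (snoc a c) (snoc b d) <= bf_next r a b + eps%:E)%E).
Proof.
move=> r0 eps0.
have H c d : exists c' d',
    (maxe (r n.+1 (snoc a c) (snoc b d')) (r n.+1 (snoc a c') (snoc b d))
       <= bf_next r a b + eps%:E)%E.
  have : bf_next r a b \is a fin_num \/ bf_next r a b = +oo%E.
    by move: r0; case: (bf_next r a b) => [x| |] // _; [left|right].
  (* If the distance is infinite, any answer is good enough. *)
  move=> [rfin|->]; last by exists point, point; rewrite addye// leey.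
  have [|_ [[c' d'] _ <-] /ltW] := @ereal_inf_lt _ [set maxe
      (r n.+1 (snoc a c) (snoc b cd'.2)) (r n.+1 (snoc a cd'.1) (snoc b d))
      | cd' in [set: A * B]] (bf_next r a b + eps%:E)%E.
    apply: (@le_lt_trans _ _ (bf_next r a b)); last by rewrite lteDl// lte_fin.
    by apply: ereal_sup_ubound; exists (c, d).
  by exists c', d'.
split=> [c|d].
  by have [c' [d]] := H c point; rewrite ge_max => /andP[+ _]; exists d.
by have [c [d']] := H point d; rewrite ge_max => /andP[_ +]; exists c.
Qed.

Lemma osup_qr_le (T : countType) n (phi : T -> formula L n) alpha i :
  (osup (range (fun i => qr (phi i))) <= alpha)%O -> (qr (phi i) <= alpha)%O.
Proof. by move/osupP => h; apply: h; [exact: countable_range|exists i]. Qed.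

Lemma interp_le_bf_dist n I (phi : formula L n) (a : 'I_n -> A) (b : 'I_n -> B)
    alpha :
  Omega_bound_formula Omega I phi -> compact_interval I -> (qr phi <= alpha)%O ->
  (`|interp phi a - interp phi b|%:E <= bf_dist Omega alpha a b)%E.
Proof.
move=> Hphi; elim: Hphi a b alpha => {n I phi}.
- move=> n I m f p cI fc fO fI a b alpha _ _.
  apply: le_trans (bf_dist_le a b (ozero_le alpha)); rewrite bf_dist0.
  apply: ereal_sup_ubound; exists (basic_formula f p) => //; split.
    by exists m, f, p.
  by exists I; split=> //; exact: OF_basic.
- move=> n I phi Hphi IH a b alpha cI /= qra.
  apply: (proj1 (sup_inf_pointwise_dist 0%N cI _ _ _)) => i.
  + exact: Omega_bound_interp.
  + exact: Omega_bound_interp.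
  + by apply: IH => //; exact: osup_qr_le.
- move=> n I phi Hphi IH a b alpha cI /= qra.
  apply: (proj2 (sup_inf_pointwise_dist 0%N cI _ _ _)) => i.
  + exact: Omega_bound_interp.
  + exact: Omega_bound_interp.
  + by apply: IH => //; exact: osup_qr_le.
- move=> n I phi Hphi IH a b alpha cI /= qra.
  (* [alpha] may be a limit, so it is first lowered to the rank of the formula itself, a successor,
     where [r] unfolds to [bf_next]. *)
  apply: le_trans (bf_dist_le a b qra); rewrite bf_distS.
  have b0 : (0 <= bf_next (bf_dist Omega (qr phi)) a b)%E.
    by rewrite -bf_distS bf_dist_ge0.
  apply: (proj1 (sup_inf_range_dist point point cI _ _ _ _)) =>
    [c|d|c eps e0|d eps e0].
  + exact: Omega_bound_interp.
  + exact: Omega_bound_interp.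
  + have [d cd] := proj1 (bf_next_extend b0 e0) c.
    by exists d; apply: le_trans cd; exact: IH.
  + have [c cd] := proj2 (bf_next_extend b0 e0) d.
    by exists c; apply: le_trans cd; exact: IH.
- move=> n I phi Hphi IH a b alpha cI /= qra.
  apply: le_trans (bf_dist_le a b qra); rewrite bf_distS.
  have b0 : (0 <= bf_next (bf_dist Omega (qr phi)) a b)%E.
    by rewrite -bf_distS bf_dist_ge0.
  apply: (proj2 (sup_inf_range_dist point point cI _ _ _ _)) =>
    [c|d|c eps e0|d eps e0].
  + exact: Omega_bound_interp.
  + exact: Omega_bound_interp.
  + have [d cd] := proj1 (bf_next_extend b0 e0) c.
    by exists d; apply: le_trans cd; exact: IH.
  + have [c cd] := proj2 (bf_next_extend b0 e0) d.
    by exists c; apply: le_trans cd; exact: IH.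
- move=> n I J k f phi cI _ IH fl _ a b alpha _ /= qra.
  apply: lipschitz1_le => // [|i]; first exact: bf_dist_ge0.
  by apply: IH => //; exact: osup_qr_le.
Qed.

End BackForth.

(** * Truncated formulas and the separating formula *)

Definition truncated_dist (q t : R) (x : {ptws 'I_1 -> R}) : R :=
  Num.min `|x ord0 - q| t.

(** Both the distance to [q] and the truncation at [t] are 1-Lipschitz, the former by the reverse
    triangle inequality. *)
Lemma truncated_dist_lipschitz q t : lipschitz1 (truncated_dist q t).
Proof.
move=> x y; rewrite big_ord_recl big_ord0 /truncated_dist.
have := ler_dist_dist (x ord0 - q) (y ord0 - q); rewrite opprB addrA subrK.
move=> le1; apply: (@le_trans _ _ `|x ord0 - y ord0|); last first.
  by rewrite le_max lexx.
apply: le_trans le1.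
move: `|x ord0 - q| `|y ord0 - q| => u v; rewrite /Num.min.
have := ler_norm (u - v); have := ler_norm (v - u); rewrite (distrC v u).
case: (ltP u t) => ut; case: (ltP v t) => vt //; rewrite ler_norml; lra.
Qed.

(* The bound has to be exactly [[0, t]], so that truncations of formulas with
   different bounds can be combined in one countable disjunction. *)
Lemma truncated_dist_formula n I (phi : formula L n) (p q t : R) :
  Omega_bound_formula Omega I phi -> compact_interval I -> I p -> I q ->
  0 <= t -> t <= `|p - q| ->
  Omega_bound_formula Omega `[0, t]%classic
    (FConn (truncated_dist q t) (fun=> phi)).
Proof.
move=> Hphi cI Ip Iq t0 tpq.
apply: OF_conn (cI) _ (@truncated_dist_lipschitz q t) _ => //.
apply/seteqP; split => [y|_ [x _ <-]]; rewrite /= in_itv/=; last first.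
  by rewrite /truncated_dist le_min normr_ge0 t0 ge_min lexx orbT.
move=> /andP[y0 yt].
have min_y : Num.min y t = y by apply/min_idPl.
have yN : `|y| = y by exact: ger0_norm.
case: cI Ip Iq => [lo [hi [_ ->]]]; rewrite /= !in_itv/=.
move=> /andP[lop p_hi] /andP[loq qhi].
(* The value [y] is attained at distance [y] from [q] on the side of [p]; this point lies between
   [q] and [p], as [y <= t <= |p - q|]. *)
move: tpq; case: (lerP q p) => pq tpq.
  exists (fun=> q + y); last by rewrite /truncated_dist addrC addKr yN.
  by move=> i; rewrite /= in_itv/=; apply/andP; split; lra.
exists (fun=> q - y); last by rewrite /truncated_dist addrC addKr normrN yN.
by move=> i; rewrite /= in_itv/=; apply/andP; split; lra.
Qed.

Lemma separable_seq (T : completeMetricType R) : separable T ->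
  exists u : nat -> T, forall x (eta : R),
    0 < eta -> exists k, mdist x (u k) < eta.
Proof.
move=> [D [/countable_injP[g gi] dD]].
(* An index that numbers no element of [D] gets the harmless value [point]. *)
pose u k := xget point [set x | D x /\ g x = k].
exists u => x eta eta0.
have [|y [xy Dy]] := dD (ball x eta)^° _ (@open_interior _ _).
  by exists x; apply: nbhs_singleton; apply: nbhs_interior; exact: nbhsx_ballx.
exists (g y); rewrite /u; case: xgetP => [z _ [Dz gzy]|/(_ y)[]//].
have -> : z = y by apply: gi; rewrite ?inE.
by have := interior_subset xy; rewrite ballEmdist.
Qed.

(** This treats one challenge [c] that no [d] answers well. The structures are arbitrary, so that
    the lemma also applies with [A] and [B] exchanged. *)
Lemma separating_formula (A B : structure L) n (a : 'I_n -> A) (b : 'I_n -> B)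
    (c : A) (t : R) alpha :
  separable B -> 0 < t ->
  (forall d, exists phi : formula L n.+1, [/\ Omega_formula Omega phi,
    (qr phi <= alpha)%O & t < `|interp phi (snoc a c) - interp phi (snoc b d)|]) ->
  exists chi : formula L n, [/\ Omega_formula Omega chi, (qr chi <= osucc alpha)%O
    & t <= `|interp chi a - interp chi b|].
Proof.
move=> /separable_seq[u ud] t0 sep.
pose phi k := sval (cid (sep (u k))).
pose q k := interp (phi k) (snoc a c).
pose psi k := FConn (truncated_dist (q k) t) (fun=> phi k).
pose chi := FInf (FCSup psi).
have phiP k : [/\ Omega_formula Omega (phi k), (qr (phi k) <= alpha)%O
    & t < `|q k - interp (phi k) (snoc b (u k))|].
  exact: svalP (cid (sep (u k))).
have ct : compact_interval `[0, t]%classic by exists 0, t; split=> //; exact: ltW.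
have psiO k : Omega_bound_formula Omega `[0, t]%classic (psi k).
  have [[I [cI phiO]] _ tq] := phiP k.
  apply: (truncated_dist_formula phiO cI (Omega_bound_interp _ phiO cI)
    (Omega_bound_interp _ phiO cI) (ltW t0)).
  by rewrite distrC; exact: ltW tq.
have csupO : Omega_bound_formula Omega `[0, t]%classic (FCSup psi).
  exact: OF_csup.
have chiO : Omega_bound_formula Omega `[0, t]%classic chi by exact: OF_inf.
exists chi; split; first by exists `[0, t]%classic.
  rewrite osuccP; apply: (@le_lt_trans _ _ alpha); last exact: ltosucc.
  apply/osupP => [|_ [k _ <-]]; first exact: countable_range.
  apply/osupP => [|_ [i _ <-]]; first exact: countable_range.
  by have [] := phiP k.
have chia : interp chi a <= 0.
  apply: (@le_trans _ _ (interp (FCSup psi) (snoc a c))).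
    apply: ge_inf; last by exists c.
    exact: (proj2 (range_bounded ct
      (fun x => Omega_bound_interp (snoc a x) csupO ct))).
  apply: ge_sup; first by exists (interp (psi 0%N) (snoc a c)), 0%N.
  move=> _ [k _ <-].
  by rewrite /= /truncated_dist -/(q k) subrr normr0 ge_min lexx.
suff chib : t <= interp chi b.
  by rewrite distrC; apply: le_trans (ler_norm _); lra.
apply: lb_le_inf; first by exists (interp (FCSup psi) (snoc b point)), point.
move=> _ [d _ <-]; apply/ler_addgt0Pr => eps eps0.
(* The radius [eta] does not depend on [k], so [u k] can be chosen close to [d] afterwards. *)
have [eta eta0 etaP] := modulus_restr_last_small OmegaP n eps0.
have [k dk] := ud d _ eta0.
apply: (@le_trans _ _ (interp (psi k) (snoc b d) + eps)); last first.
  rewrite lerD2r; apply: ub_le_sup; last by exists k.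
  exact: (proj1 (range_bounded ct
    (fun i => Omega_bound_interp (snoc b d) (psiO i) ct))).
have psit : interp (psi k) (snoc b (u k)) = t.
  have [_ _ tq] := phiP k; rewrite /= /truncated_dist; apply/min_idPr.
  by rewrite distrC ltW.
(* Only the last variable moves, from [d] to [u k], so [psi k] changes by less than [eps]. *)
have := Omega_bound_interp_dist (snoc b d) (snoc b (u k)) (psiO k) ct.
rewrite snoc_mdist (_ : (fun i : 'I_n => _) = fun=> 0); last first.
  by apply/funext => i; rewrite mdistxx.
move=> /le_lt_trans/(_ (etaP _ (mdist_ge0 _ _) dk)).
by rewrite psit lte_fin ltr_norml => /andP[? _]; lra.
Qed.

End Formulas.

(** * Transfinite induction for the equality *)

Lemma lt_pos_between {R : realType} (x y : \bar R) : (0 <= x)%E -> (x < y)%E ->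
  exists t : R, [/\ 0 < t, (x < t%:E)%E & (t%:E < y)%E].
Proof.
case: x => [x| |] //; case: y => [y| |] //; rewrite ?lte_fin lee_fin => x0 xy.
  by exists ((x + y) / 2); rewrite !lte_fin; split; lra.
by exists (x + 1); rewrite lte_fin ltry; split => //; lra.
Qed.

Theorem theorem1p1 (R : realType) (L : signature R)
    (Omega : {ptws nat -> R} -> \bar R) (A B : structure L)
    (n : nat) (a : 'I_n -> A) (b : 'I_n -> B) (alpha : omega1) :
  countable_signature L -> weak_modulus Omega ->
  separable A -> separable B ->
  bf_dist Omega alpha a b =
  ereal_sup [set `|interp phi a - interp phi b|%:E | phi in
    [set phi : formula L n | Omega_formula Omega phi /\ (qr phi <= alpha)%O]].
Proof.
move=> _ OmegaP sA sB; apply/eqP; rewrite eq_le; apply/andP; split; last first.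
  apply: ge_ereal_sup => _ [phi [[I [cI phiO]] qphi] <-].
  exact: interp_le_bf_dist phiO cI qphi.
elim/(well_founded_ind omega1_wf): alpha n a b => alpha IH n a b.
have [->|n0] := pselect (alpha = ozero).
  rewrite bf_dist0; apply: ereal_sup_le => _ [phi [[m [f [p [_ ->]]]] phiO] <-].
  exists (basic_formula f p) => //; split=> //=.
  by apply/osupP => [|_ [i _ <-]]; [exact: countable_range|].
have [[beta alphaE]|nS] := pselect (exists beta, alpha = osucc beta); last first.
  rewrite bf_dist_lim//; last by move=> beta E; apply: nS; exists beta.
  apply: ge_ereal_sup => _ [beta beta_lt <-].
  apply: (le_trans (IH _ beta_lt _ _ _)).
  apply: ereal_sup_le => _ [phi [phiO qphi] <-].
  by exists phi => //; split=> //; apply: le_trans qphi _; exact: ltW.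
rewrite alphaE bf_distS; apply: ge_ereal_sup => _ [[c d] _ <-] /=.
(* Suppose the supremum [S] over formulas is less than the infimum over all answers to the challenge
   [(c, d)]; a real [t] is then taken strictly between. *)
rewrite leNgt; apply/negP; set S := ereal_sup _ => S_lt.
have S_ub chi : Omega_formula Omega chi -> (qr chi <= osucc beta)%O ->
    (`|interp chi a - interp chi b|%:E <= S)%E.
  by move=> chiO qchi; apply: ereal_sup_ubound; exists chi.
(* The constant [0] is one of the formulas; [0 <= S] is what makes [t] positive. *)
have S0 : (0 <= S)%E.
  have no (i : 'I_0) : formula L n by case: i.
  pose zero := FConn (fun=> 0) no.
  apply: (@le_trans _ _ `|interp zero a - interp zero b|%:E).
    by rewrite lee_fin.
  apply: S_ub; first exact: const_Omega_formula.
  by apply/osupP => [|_ [[i ilt] _ <-]]; first exact: countable_range.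
have [t [t0 St ti]] := lt_pos_between S0 S_lt.
have split_max c' d' :
    (t%:E < maxe (bf_dist Omega beta (snoc a c) (snoc b d'))
                 (bf_dist Omega beta (snoc a c') (snoc b d)))%E.
  by apply: lt_le_trans ti _; apply: ereal_inf_lbound; exists (c', d').
have beta_lt : (beta < alpha)%O by rewrite alphaE ltosucc.
(* The induction hypothesis at [beta] turns a distance above [t] into a formula. *)
have far (x : 'I_n.+1 -> A) (y : 'I_n.+1 -> B) :
    (t%:E < bf_dist Omega beta x y)%E ->
    exists phi : formula L n.+1, [/\ Omega_formula Omega phi, (qr phi <= beta)%O
      & t < `|interp phi x - interp phi y|].
  move=> /lt_le_trans/(_ (IH _ beta_lt _ x y)).
  move=> /ereal_sup_gt[_ [phi [phiO qphi] <-]].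
  by rewrite lte_fin => ?; exists phi.
(* Either [c] is far from every [d'], or some [d'] is not far from [c]; in the latter case
   [split_max] at this [d'] puts every [c'] far from [d]. *)
have [hc|/existsNP[d' /negP]] := pselect (forall d',
    (t%:E < bf_dist Omega beta (snoc a c) (snoc b d'))%E).
  have [chi [chiO qchi]] :=
    separating_formula OmegaP sB t0 (fun d' => far _ _ (hc d')).
  (* The formula [chi] gives [t <= S], against [S < t]. *)
  rewrite -lee_fin => /le_trans/(_ (S_ub _ chiO qchi)).
  by rewrite leNgt St.
rewrite -leNgt => hd'.
have hd c' : (t%:E < bf_dist Omega beta (snoc a c') (snoc b d))%E.
  by have := split_max c' d'; rewrite lt_max ltNge hd'.
(* The roles of the two structures are exchanged, with [d] as the challenge. *)
have [|chi [chiO qchi]] :=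
    @separating_formula _ _ _ OmegaP B A n b a d t beta sA t0.
  move=> c'; have [phi [phiO qphi]] := far _ _ (hd c').
  by rewrite distrC; exists phi.
rewrite distrC -lee_fin => /le_trans/(_ (S_ub _ chiO qchi)).
by rewrite leNgt St.
Qed.
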